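(* For every integer $n\geq 0$, \[ M_{bd}(0,2,2n)>M_{bd}(1,2,2n)\qquad\text{and}\qquad M_{bd}(1,2,2n+1)>M_{bd}(0,2,2n+1). \]
   Context: A partition with designated summands is an integer partition in which, for each distinct part size occurring, exactly one of the parts of that size is tagged (designated). A bipartition of $n$ with designated summands is an ordered pair $(\lambda_1,\lambda_2)$ of partitions with designated summands with $|\lambda_1|+|\lambda_2|=n$. Fix a bijection $\Delta$ (such a bijection exists) between partitions of $N$ with designated summands and pairs $(\alpha,\beta)$ with $|\alpha|+|\beta|=N$, where $\alpha$ is an ordinary partition and $\beta$ is a partition into parts $\not\equiv\pm1 \pmod 6$. If $\Delta(\lambda_1)=(\alpha_1,\beta_1)$ and $\Delta(\lambda_2)=(\alpha_2,\beta_2)$, the $pd$-crank of $(\lambda_1,\lambda_2)$ is $\ell(\alpha_1)-\ell(\alpha_2)$, where $\ell(\alpha)$ is the number of parts of $\alpha$. Because $\Delta$ is a bijection, $M_{bd}(m,n)$, the number of bipartitions of $n$ with designated summands having $pd$-crank $m$, equals the number of quadruples $(\alpha_1,\beta_1,\alpha_2,\beta_2)$ with $\alpha_1,\alpha_2$ ordinary partitions, $\beta_1,\beta_2$ partitions into parts $\not\equiv\pm1\pmod 6$, $|\alpha_1|+|\beta_1|+|\alpha_2|+|\beta_2|=n$ and $\ell(\alpha_1)-\ell(\alpha_2)=m$. Equivalently, \[ \sum_{m\in\mathbb Z}\sum_{n\ge0}M_{bd}(m,n)z^mq^n=\frac{(q^6;q^6)_\infty^2}{(zq;q)_\infty(z^{-1}q;q)_\infty(q^2;q^2)_\infty^2(q^3;q^3)_\infty^2},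 \] where $(a;q)_\infty=\prod_{j\ge1}(1-aq^{j-1})$. $M_{bd}(k,t,n)$ denotes the number of bipartitions of $n$ with designated summands whose $pd$-crank is congruent to $k$ modulo $t$, i.e. $M_{bd}(k,t,n)=\sum_{m\equiv k \,(\mathrm{mod}\, t)}M_{bd}(m,n)$. *)

(* Defs.v *)
From mathcomp Require Import all_boot all_order all_algebra.
Set Implicit Arguments.
Unset Strict Implicit.
Unset Printing Implicit Defensive.

Definition is_partition (n : nat) (s : seq nat) : bool :=
  [&& sorted geq s, 0 \notin s & sumn s == n].

Definition no_part_pm1_mod6 (s : seq nat) : bool :=
  all (fun x => (x != 1 %[mod 6]) && (x != 5 %[mod 6])) s.

(* The entry (x, b) is a part x, designated when b = true. The position of the
   designated copy among equal parts matters: 1' + 1 and 1 + 1' differ. *)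
Definition is_designated_partition (n : nat) (s : seq (nat * bool)) : bool :=
  is_partition n (unzip1 s) &&
  all (fun x => count_mem (x, true) s == 1) (unzip1 s).

(* A partition of n has at most n parts, each at most n, so the bounds in the
   carriers below exclude nothing; they only make the types finite. *)
Definition partition_of (n : nat) : Type :=
  {s : {bseq n of 'I_n.+1} | is_partition n (map val s)}.

Definition partition6_of (n : nat) : Type :=
  {s : {bseq n of 'I_n.+1} |
     is_partition n (map val s) && no_part_pm1_mod6 (map val s)}.

Definition designated_partition_of (n : nat) : Type :=
  {s : {bseq n of ('I_n.+1 * bool)%type} |
     is_designated_partition n [seq (val p.1, p.2) | p <- s]}.

Definition num_parts (n : nat) (a : partition_of n) : nat := size (val a).

(* Pairs (alpha, beta) with |alpha| + |beta| = n, tagged by i = |alpha|. *)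
Definition alpha_beta_of (n : nat) : Type :=
  {i : 'I_n.+1 & (partition_of i * partition6_of (n - i))%type}.

Definition ell_alpha (n : nat) (ab : alpha_beta_of n) : nat :=
  num_parts (tagged ab).1.

(* Pairs (lambda1, lambda2) with |lambda1| + |lambda2| = n, tagged by
   i = |lambda1|. *)
Definition designated_bipartition_of (n : nat) : Type :=
  {i : 'I_n.+1 &
     (designated_partition_of i * designated_partition_of (n - i))%type}.

Definition pd_crank (Delta : forall N, designated_partition_of N -> alpha_beta_of N)
    (n : nat) (l : designated_bipartition_of n) : int :=
  ((ell_alpha (Delta _ (tagged l).1))%:Z - (ell_alpha (Delta _ (tagged l).2))%:Z)%R.

Definition M_bd (Delta : forall N, designated_partition_of N -> alpha_beta_of N)
    (k t : int) (n : nat) : nat :=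
  #|[set l : designated_bipartition_of n | (pd_crank Delta l == k %[mod t])%Z]|.

(* Main.v *)
Require Import Defs.
From mathcomp Require Import all_boot all_order all_algebra.
From mathcomp Require Import zify.

(** Weight each pair [(alpha, beta)] of total size [N] by [(-1)^l(alpha)].  For
    a part size [m] other than [+-1 mod 6], a copy of [m] may be moved between
    [alpha] and [beta]; doing this for the least [m] that has an odd multiplicity
    in [alpha] or occurs in [beta] is a sign-reversing involution.  In a fixed
    point [beta] is empty and every even part of [alpha] has even multiplicity,
    so [l(alpha)] and [N] have the same parity.  Since [(1^N, empty)] is fixed,
    the signed count of pairs has the sign [(-1)^N].  The signed count of
    bipartitions of [n] is the convolution of these counts, hence has the sign
    [(-1)^n]. *)

Set Implicit Arguments.
Unset Strict Implicit.
Unset Printing Implicit Defensive.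

(** * Decreasing sequences: inserting and removing a part, sums, parities *)

Lemma geq_total : total geq.
Proof. by move=> m n; rewrite /= orbC leq_total. Qed.

Lemma geq_trans : transitive geq.
Proof. by move=> n m p /= le_nm le_pn; apply: leq_trans le_pn le_nm. Qed.

Lemma geq_anti : antisymmetric geq.
Proof. by move=> m n /= /andP[le_nm le_mn]; apply/eqP; rewrite eqn_leq le_mn. Qed.

Lemma sorted_geq_rem (x : nat) (s : seq nat) : sorted geq s -> sorted geq (rem x s).
Proof. exact: (subseq_sorted geq_trans (rem_subseq x s)). Qed.

Lemma sort_geq_cons_rem (x : nat) (s : seq nat) :
  sorted geq s -> x \in s -> sort geq (x :: rem x s) = s.
Proof.
move=> s_sorted xs; apply: (sorted_eq geq_trans geq_anti) => //.
  exact: sort_sorted geq_total _.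
by rewrite perm_sort perm_sym perm_to_rem.
Qed.

Lemma rem_sort_geq_cons (x : nat) (s : seq nat) :
  sorted geq s -> rem x (sort geq (x :: s)) = s.
Proof.
move=> s_sorted; apply: (sorted_eq geq_trans geq_anti) => //.
  by apply: sorted_geq_rem; exact: sort_sorted geq_total _.
rewrite -(perm_cons x) perm_sym.
have xs : x \in sort geq (x :: s) by rewrite mem_sort mem_head.
by apply: perm_trans (perm_to_rem xs); rewrite perm_sym perm_sort.
Qed.

Lemma sumn_sort_cons (x : nat) (s : seq nat) : sumn (sort geq (x :: s)) = x + sumn s.
Proof. by rewrite (perm_sumn (s2 := x :: s)) // perm_sort. Qed.

Lemma sumn_rem (x : nat) (s : seq nat) : x \in s -> sumn s = x + sumn (rem x s).
Proof. by move=> xs; rewrite (perm_sumn (perm_to_rem xs)). Qed.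

Lemma leq_sumn (x : nat) (s : seq nat) : x \in s -> x <= sumn s.
Proof. by move/sumn_rem->; apply: leq_addr. Qed.

Lemma size_leq_sumn (s : seq nat) : 0 \notin s -> size s <= sumn s.
Proof. by elim: s => //= x s IHs; rewrite inE negb_or => /andP[? /IHs]; lia. Qed.

(** Grouping the entries that satisfy [p] by value writes the count as a sum of multiplicities, each
    of them even. *)
Lemma even_count (T : eqType) (p : pred T) (s : seq T) :
  (forall x, p x -> ~~ odd (count_mem x s)) -> ~~ odd (count p s).
Proof.
move=> even_mult; rewrite -sum1_count -big_undup_iterop_count.
apply: (big_ind (fun m => ~~ odd m)) => // [m n | x px].
  by rewrite oddD => /negPf-> /negPf->.
have := even_mult x px.
suff -> : iterop (count_mem x s) addn 1 0 = count_mem x s by [].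
by case: (count_mem x s) => // k; elim: k => //= k ->.
Qed.

(** Each part [x] contributes the parity of [x + 1] to the left side, which is odd exactly when [x]
    is even. *)
Lemma odd_sumn_size (s : seq nat) :
  odd (sumn s) (+) odd (size s) = odd (count (fun x => ~~ odd x) s).
Proof.
elim: s => //= x s; rewrite !oddD => <-.
by case: (odd x); case: (odd (sumn s)); case: (odd (size s)).
Qed.

(** * The sign-reversing involution on pairs of sequences *)

Definition pm1_mod6 (x : nat) : bool := (x == 1 %[mod 6]) || (x == 5 %[mod 6]).

Definition movable (p : seq nat * seq nat) (x : nat) : bool :=
  ~~ pm1_mod6 x && (odd (count_mem x p.1) || (x \in p.2)).

(** The parity of the multiplicity in [p.1] chooses the direction. A move flips this parity, so the
    next move of [x] goes back. *)
Definition move_part (x : nat) (p : seq nat * seq nat) : seq nat * seq nat :=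
  if odd (count_mem x p.1) then (rem x p.1, sort geq (x :: p.2))
  else (sort geq (x :: p.1), rem x p.2).

(** The range [1..N] contains every part of a pair of total size [N]. *)
Definition least_movable (N : nat) (p : seq nat * seq nat) : option nat :=
  ohead [seq x <- iota 1 N | movable p x].

Definition move_least (N : nat) (p : seq nat * seq nat) : seq nat * seq nat :=
  if least_movable N p is Some x then move_part x p else p.

Definition partition_pair (N : nat) (p : seq nat * seq nat) : bool :=
  [&& sorted geq p.1, 0 \notin p.1, sorted geq p.2, 0 \notin p.2,
      no_part_pm1_mod6 p.2 & sumn p.1 + sumn p.2 == N].

Lemma no_part_pm1_mod6E (s : seq nat) :
  no_part_pm1_mod6 s = all (fun x => ~~ pm1_mod6 x) s.
Proof. by apply: eq_all => x; rewrite negb_or. Qed.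

Lemma least_movable_Some {N p x} :
  least_movable N p = Some x -> 0 < x /\ movable p x.
Proof.
rewrite /least_movable => def_x.
have: x \in [seq x <- iota 1 N | movable p x].
  by case: [seq _ <- _ | _] def_x => //= y s [->]; rewrite mem_head.
by rewrite mem_filter mem_iota => /andP[-> /andP[-> _]].
Qed.

Lemma least_movable_None {N p} x :
  least_movable N p = None -> 0 < x <= N -> ~~ movable p x.
Proof.
rewrite /least_movable => def_x x_range; apply/negP => mov_x.
have: x \in [seq x <- iota 1 N | movable p x] by rewrite mem_filter mem_iota mov_x; lia.
by case: [seq _ <- _ | _] def_x.
Qed.

Lemma odd_count_mem x (s : seq nat) : odd (count_mem x s) -> x \in s.
Proof. by rewrite -has_pred1 has_count; case: count. Qed.

Lemma movable_mem2 {p x} : movable p x -> ~~ odd (count_mem x p.1) -> x \in p.2.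
Proof. by case/andP=> _ /orP[->|]. Qed.

Lemma odd_move_part x p :
  odd (count_mem x (move_part x p).1) = ~~ odd (count_mem x p.1).
Proof.
rewrite /move_part; case: ifP => odd_x /=.
  by rewrite count_mem_rem eqxx; case: count odd_x => //= k /negPf; rewrite subn1.
by rewrite count_sort /= eqxx oddD odd_x.
Qed.

(** After the move, [x] either has odd multiplicity in the first component or has just entered the
    second; other sizes keep their multiplicities. Hence the least movable size is the same before
    and after. *)
Lemma movable_move_part x p : movable p x -> movable (move_part x p) =1 movable p.
Proof.
move=> mov_x y; have [->|ne_yx] := eqVneq y x.
  rewrite mov_x /movable odd_move_part; case/andP: mov_x => -> _ /=.
  by rewrite /move_part; case: ifP => //= _; rewrite mem_sort mem_head.
have mem_rem_neq s : (y \in rem x s) = (y \in s).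
  by rewrite -!has_pred1 !has_count count_mem_rem eq_sym (negPf ne_yx) subn0.
rewrite /movable /move_part; case: ifP => _ /=.
  by rewrite count_mem_rem mem_sort inE eq_sym (negPf ne_yx) subn0.
by rewrite count_sort /= mem_rem_neq eq_sym (negPf ne_yx).
Qed.

Lemma move_partK N x p :
  partition_pair N p -> movable p x -> move_part x (move_part x p) = p.
Proof.
case: p => a b /and5P[/= a_sorted _ b_sorted _ _] mov_x.
rewrite {1}/move_part odd_move_part /=; have := movable_mem2 mov_x; rewrite /move_part /=.
case: (boolP (odd _)) => [/odd_count_mem xa _ | _ /(_ isT) xb] /=.
  by rewrite sort_geq_cons_rem ?rem_sort_geq_cons.
by rewrite sort_geq_cons_rem ?rem_sort_geq_cons.
Qed.

Lemma move_least_neq N p : least_movable N p != None -> move_least N p <> p.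
Proof.
rewrite /move_least; case: least_movable => // x _ eq_p.
by have := odd_move_part x p; rewrite eq_p; case: odd.
Qed.

Lemma move_leastK N p : partition_pair N p -> move_least N (move_least N p) = p.
Proof.
move=> Pp; rewrite {2}/move_least; case def_x: least_movable => [x|]; last first.
  by rewrite /move_least def_x.
have [_ mov_x] := least_movable_Some def_x.
rewrite /move_least {1}/least_movable (eq_filter (movable_move_part mov_x)).
by rewrite -/(least_movable N p) def_x (move_partK Pp).
Qed.

(** A movable size is positive and not [+-1 mod 6], so it is allowed in either component. *)
Lemma partition_pair_move_least N p :
  partition_pair N p -> partition_pair N (move_least N p).
Proof.
rewrite /move_least; case def_x: least_movable => [x|] // Pp.
have [x_gt0 mov_x] := least_movable_Some def_x.
case/and5P: Pp => sa a0 sb b0 /andP[pm_b /eqP sum_p].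
have [pm_x _] := andP mov_x; have := movable_mem2 mov_x.
have rem0 s : 0 \notin s -> 0 \notin rem x s by apply: contra => /mem_rem.
have cons0 s : 0 \notin s -> 0 \notin sort geq (x :: s).
  by rewrite mem_sort inE negb_or => ->; rewrite andbT; lia.
rewrite /partition_pair /move_part; case: ifP => [/odd_count_mem xa _ | _ /(_ isT) xb] /=.
  rewrite sorted_geq_rem // rem0 // (sort_sorted geq_total) cons0 //=.
  rewrite sumn_sort_cons no_part_pm1_mod6E all_sort /= pm_x -no_part_pm1_mod6E pm_b /=.
  by rewrite -sum_p (sumn_rem xa) addnA (addnC x).
rewrite sorted_geq_rem // rem0 // (sort_sorted geq_total) cons0 //=.
rewrite sumn_sort_cons -sum_p (sumn_rem xb) addnA (addnC x) eqxx andbT.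
by apply/allP => y /mem_rem /(allP pm_b).
Qed.

Lemma odd_size_move_least N p : partition_pair N p -> move_least N p <> p ->
  odd (size (move_least N p).1) = ~~ odd (size p.1).
Proof.
rewrite /move_least; case def_x: least_movable => [x|] // _ _.
rewrite /move_part; case: ifP => [/odd_count_mem xa | _] /=; last by rewrite size_sort.
by rewrite size_rem //; case: p.1 xa => //= y s _; rewrite negbK.
Qed.

Lemma odd_size_fixed N p : partition_pair N p -> move_least N p = p ->
  odd (size p.1) = odd N.
Proof.
move=> Pp fix_p; have noneP: least_movable N p = None.
  by apply/eqP; apply/negPn/negP => /move_least_neq; apply.
case: p Pp {fix_p} noneP => a b /and5P[/= sa a0 sb b0 /andP[pm_b /eqP sum_p]] noneP.
(* Any part of [b] is movable, being allowed in the second component. *)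
have b_nil: b = [::].
  case: b => // x b in sb b0 pm_b sum_p noneP *.
  have x_range: 0 < x <= N by move: b0; rewrite inE negb_or -sum_p /=; lia.
  have := least_movable_None noneP x_range; rewrite /movable /= mem_head orbT andbT.
  by move: pm_b; rewrite no_part_pm1_mod6E => /andP[->].
(* An even size is never [+-1 mod 6], so with odd multiplicity in [a] it would be movable. *)
have : ~~ odd (count (fun x => ~~ odd x) a).
  apply: even_count => x even_x; apply/negP => odd_x.
  have xa := odd_count_mem odd_x.
  have x_range: 0 < x <= N.
    have : x != 0 by apply: contra a0 => /eqP <-.
    by have := leq_sumn xa; lia.
  have := least_movable_None noneP x_range; rewrite /movable /= odd_x /= andbT.
  by rewrite /pm1_mod6; lia.
rewrite -odd_sumn_size -sum_p b_nil /= addn0.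
by case: (odd (sumn a)); case: odd.
Qed.

(** The only size present is 1, which is [1 mod 6] and so not movable. *)
Lemma move_least_nseq N : move_least N (nseq N 1, [::]) = (nseq N 1, [::]).
Proof.
rewrite /move_least; case def_x: least_movable => [x|] //.
have [_ /andP[pm_x]] := least_movable_Some def_x.
rewrite orbF => /odd_count_mem; rewrite mem_nseq => /andP[_ /eqP x1].
by rewrite x1 in pm_x.
Qed.

(** * Transfer between the finite types and plain sequences *)

Definition parts_of N (ab : alpha_beta_of N) : seq nat * seq nat :=
  (map val (val (val (tagged ab).1)), map val (val (val (tagged ab).2))).

Lemma partition_pair_parts_of N (ab : alpha_beta_of N) : partition_pair N (parts_of ab).
Proof.
case: ab => i [[a Pa] [b Pb]]; rewrite /partition_pair /parts_of /=.
case/and3P: (Pa) => -> -> /eqP->; case/andP: (Pb) => /and3P[-> -> /eqP->] -> /=.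
by rewrite subnKC // -ltnS.
Qed.

Lemma parts_of_inj N : injective (@parts_of N).
Proof.
case=> i [a b] [j [a' b']] eq_p.
(* The tag is recovered as the sum of the first component. *)
have eq_ij: i = j.
  apply: val_inj; case: eq_p => eq_a _.
  have /and3P[_ _ /eqP def_i] := valP a; have /and3P[_ _ /eqP def_j] := valP a'.
  by rewrite -[LHS]def_i -[RHS]def_j eq_a.
case: j / eq_ij a' b' eq_p => a' b' [eq_a eq_b].
have -> : a = a' by do 2!apply: val_inj; apply: (inj_map val_inj).
by have -> : b = b' by do 2!apply: val_inj; apply: (inj_map val_inj).
Qed.

Lemma bseq_of_partition N s : is_partition N s ->
  exists t : {bseq N of 'I_N.+1}, map val t = s.
Proof.
case/and3P=> _ s0 /eqP sum_s.
have sz : size (map (@inord N) s) <= N by rewrite size_map -sum_s size_leq_sumn.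
exists (Bseq sz); rewrite /= -map_comp map_id_in // => x xs /=.
by rewrite inordK // ltnS -sum_s leq_sumn.
Qed.

Lemma parts_of_surj N p : partition_pair N p -> exists ab : alpha_beta_of N, parts_of ab = p.
Proof.
case: p => a b /and5P[/= sa a0 sb b0 /andP[pm_b /eqP sum_p]].
have lt_a: sumn a < N.+1 by rewrite -sum_p ltnS leq_addr.
have Pa: is_partition (sumn a) a by rewrite /is_partition sa a0 eqxx.
have Pb: is_partition (N - sumn a) b by rewrite /is_partition sb b0 -sum_p addKn eqxx.
have [ta def_a] := bseq_of_partition Pa; have [tb def_b] := bseq_of_partition Pb.
have {}Pa: is_partition (sumn a) (map val ta) by rewrite def_a.
have {}Pb: is_partition (N - sumn a) (map val tb) && no_part_pm1_mod6 (map val tb).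
  by rewrite def_b Pb pm_b.
exists (Tagged (fun i : 'I_N.+1 => (partition_of i * partition6_of (N - i))%type)
  (i := Ordinal lt_a) (exist _ ta Pa, exist _ tb Pb)).
by rewrite /parts_of /= def_a def_b.
Qed.

(** * Signed counts and their convolution *)

Import Order.Theory GRing.Theory Num.Theory.
Local Open Scope ring_scope.

Lemma sum_fixed_points (T : finType) (f : T -> T) (w : T -> int) :
  involutive f -> (forall x, f x != x -> w (f x) = - w x) ->
  \sum_x w x = \sum_(x | f x == x) w x.
Proof.
move=> fK w_f; rewrite (bigID (fun x => f x == x)) /=.
(* Reindexing the sum over non-fixed points by [f] negates it. *)
set s := (X in _ + X); suff eq_s : s = - s.
  by rewrite (_ : s = 0) ?addr0 //; move: eq_s; clearbody s; lia.
rewrite /s.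
rewrite {1}(reindex_inj (inv_inj fK)) -sumrN /=.
by apply: eq_big => x; rewrite fK eq_sym //; apply: w_f.
Qed.

Lemma sign_signed_count_gt0 N :
  0 < (-1) ^+ N * \sum_(ab : alpha_beta_of N) (-1) ^+ ell_alpha ab :> int.
Proof.
(* This is [move_least] carried over to [alpha_beta_of N]. By [parts_of_surj] the [pick] always
   succeeds, so the default [ab] is never returned. *)
pose f (ab : alpha_beta_of N) :=
  odflt ab [pick ab' | parts_of ab' == move_least N (parts_of ab)].
have parts_f ab : parts_of (f ab) = move_least N (parts_of ab).
  rewrite /f; case: pickP => [ab' /eqP // | no_ab].
  have [ab' /eqP] := parts_of_surj (partition_pair_move_least (partition_pair_parts_of ab)).
  by rewrite no_ab.
have ellE (ab : alpha_beta_of N) : ell_alpha ab = size (parts_of ab).1 by rewrite size_map.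
have fixE ab : (f ab == ab) = (move_least N (parts_of ab) == parts_of ab).
  by rewrite -parts_f (inj_eq (@parts_of_inj N)).
have fK : involutive f.
  by move=> ab; apply: parts_of_inj; rewrite !parts_f move_leastK ?partition_pair_parts_of.
rewrite (sum_fixed_points fK) => [|ab]; last first.
  rewrite fixE => /eqP nfix; rewrite !ellE parts_f -signr_odd.
  rewrite (odd_size_move_least (partition_pair_parts_of ab) nfix).
  by rewrite signrN signr_odd.
(* Every fixed point contributes [(-1)^N * (-1)^N = 1]. *)
rewrite mulr_sumr (eq_bigr (fun=> 1)) => [|ab]; last first.
  rewrite fixE => /eqP fix_ab; rewrite -signr_odd ellE -[X in _ * X]signr_odd.
  by rewrite (odd_size_fixed (partition_pair_parts_of ab) fix_ab) -expr2 sqrr_sign.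
(* The all-ones partition provides a fixed point, which makes the sum strictly positive. *)
have [ab def_ab] : exists ab : alpha_beta_of N, parts_of ab = (nseq N 1%N, [::]).
  apply: parts_of_surj; rewrite /partition_pair /= sumn_nseq addn0 mul1n eqxx mem_nseq andbF.
  by rewrite andbT; case: N {f parts_f ellE fixE fK} => //= N; elim: N => //= N ->.
rewrite (bigD1 ab) /=; last by rewrite fixE def_ab move_least_nseq.
by rewrite ltr_pwDl // sumr_ge0.
Qed.

(** The difference sums [(-1)] to the power of the crank. A difference of lengths has the parity of
    their sum, so this sign factors over the two components, and [Delta] reindexes each factor. *)
Lemma M_bd_sub (Delta : forall N, designated_partition_of N -> alpha_beta_of N) (n : nat) :
  (forall N, bijective (Delta N)) ->
  (M_bd Delta 0%Z 2%Z n)%:Z - (M_bd Delta 1%Z 2%Z n)%:Z =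
  \sum_(i < n.+1) (\sum_(ab : alpha_beta_of i) (-1) ^+ ell_alpha ab) *
                  (\sum_(ab : alpha_beta_of (n - i)) (-1) ^+ ell_alpha ab).
Proof.
move=> Delta_bij.
have M_bdE k : (M_bd Delta k 2%Z n)%:Z =
    \sum_(l : designated_bipartition_of n) ((pd_crank Delta l == k %[mod 2%Z])%Z : nat)%:Z.
  rewrite /M_bd -sum1_card big_mkcond /= -[LHS]natz natr_sum.
  by apply: eq_bigr => l _; rewrite inE natz; case: ifP.
pose sign_of N (l : designated_partition_of N) : int := (-1) ^+ ell_alpha (Delta N l).
have sum_sign N : \sum_(ab : alpha_beta_of N) (-1) ^+ ell_alpha ab = \sum_l @sign_of N l.
  by have [g gK Kg] := Delta_bij N; rewrite (reindex (Delta N)) //; exists g => l _.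
rewrite !M_bdE -sumrB.
under [RHS]eq_bigr do rewrite !sum_sign big_distrlr /= pair_bigA /=.
rewrite sig_big_dep /=; apply: eq_bigr => -[i [l1 l2]] _.
rewrite /pd_crank /sign_of /= -exprD -signr_odd oddD.
set m1 := ell_alpha _; set m2 := ell_alpha _.
case: (boolP (odd m1)); case: (boolP (odd m2)) => /=; lia.
Qed.

Lemma sign_M_bd_sub (Delta : forall N, designated_partition_of N -> alpha_beta_of N) (n : nat) :
  (forall N, bijective (Delta N)) ->
  0 < (-1) ^+ n * ((M_bd Delta 0%Z 2%Z n)%:Z - (M_bd Delta 1%Z 2%Z n)%:Z).
Proof.
move=> /M_bd_sub->; rewrite mulr_sumr.
have term_gt0 (i : 'I_n.+1) :
    0 < (-1) ^+ n * ((\sum_(ab : alpha_beta_of i) (-1) ^+ ell_alpha ab) *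
      (\sum_(ab : alpha_beta_of (n - i)) (-1) ^+ ell_alpha ab)) :> int.
  have le_in : (i <= n)%N by rewrite -ltnS.
  (* Split [(-1)^n] as [(-1)^i * (-1)^(n - i)], one sign for each signed count. *)
  rewrite -{1}(subnKC le_in) exprD mulrACA.
  by apply: mulr_gt0; apply: sign_signed_count_gt0.
rewrite (bigD1 ord0) //; apply: ltr_pwDl; first exact: term_gt0.
by apply: sumr_ge0 => i _; apply: ltW (term_gt0 i).
Qed.

Local Close Scope ring_scope.

Theorem theorem2p4
    (Delta : forall N : nat, designated_partition_of N -> alpha_beta_of N)
    (Delta_bij : forall N : nat, bijective (Delta N))
    (n : nat) :
  M_bd Delta 0%Z 2%Z (2 * n) > M_bd Delta 1%Z 2%Z (2 * n) /\
  M_bd Delta 1%Z 2%Z (2 * n + 1) > M_bd Delta 0%Z 2%Z (2 * n + 1).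
Proof.
have even_n := sign_M_bd_sub (2 * n) Delta_bij.
have odd_n := sign_M_bd_sub (2 * n + 1) Delta_bij.
(* The sign is [1] at [2 * n] and [-1] at [2 * n + 1]. *)
move: even_n odd_n; rewrite addn1 exprS exprM sqrrN !expr1n; lia.
Qed.
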